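(* Let $\alpha,\beta,\gamma\in\widehat{\kappa^*}$ satisfy $(\alpha+\alpha\gamma,\beta)=(\gamma,\varepsilon)=0$, and let $f\colon\widehat{\kappa^*}\to\mathbb{C}$ be any map. Then for all $x,y\in\kappa$ with $x\neq 0,1$, \[ \sum_{\nu,\mu\in\widehat{\kappa^*}} f(\mu)\frac{(\alpha)_{\nu\mu}(\gamma)_\nu(\beta\overline{\gamma})_\mu}{(\beta)^\circ_{\nu\mu}(\varepsilon)^\circ_\nu(\varepsilon)^\circ_\mu}\nu(x)\mu(y) =\overline{\alpha}(1-x)\sum_{\eta\in\widehat{\kappa^*}}\frac{(\alpha+\beta\overline{\gamma})_\eta}{(\beta+\varepsilon)^\circ_\eta}\,\eta\!\left(\frac{x}{x-1}\right)\sum_{\mu\in\widehat{\kappa^*}} f(\mu)\frac{(\overline{\eta})_\mu}{(\varepsilon)^\circ_\mu}\,\mu\!\left(\frac{y}{x}\right) +(1-q)^2 f(\overline{\beta}\gamma)\,\overline{\gamma}(x)\,\overline{\beta}\gamma(y)\,\frac{(\varepsilon)^\circ_\beta}{(\overline{\alpha})^\circ_\beta}. \]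
   Context: Let $\kappa$ be a finite field of characteristic $p$ with $q$ elements and $\widehat{\kappa^*}=\mathrm{Hom}(\kappa^*,\mathbb{C}^* )$ its group of multiplicative characters, written multiplicatively; every character $\varphi$ is extended to $\kappa$ by $\varphi(0)=0$. $\varepsilon$ is the trivial character and $\overline{\varphi}=\varphi^{-1}$ (so e.g. $\overline{\alpha\beta}=(\alpha\beta)^{-1}$ and $\overline{\beta}\gamma(y)=\beta^{-1}\gamma(y)$). $\delta(\varphi)=1$ if $\varphi=\varepsilon$ and $0$ otherwise. Fix a nontrivial additive character $\psi$ of $\kappa$; Gauss sums are $g(\varphi)=-\sum_{x\in\kappa}\varphi(x)\psi(x)$ and $g^\circ(\varphi)=q^{\delta(\varphi)}g(\varphi)$. Pochhammer symbols: $(\varphi)_\nu=g(\varphi\nu)/g(\varphi)$, $(\varphi)^\circ_\nu=g^\circ(\varphi\nu)/g^\circ(\varphi)$. Let $P$ be the free abelian monoid on $\widehat{\kappa^*}$, written additively (a formal sum $\alpha+\beta$, not a product). The symmetric pairing $(\cdot,\cdot)\colon P\times P\to\mathbb{Z}_{\ge0}$ extends bilinearly $(\alpha,\beta)=\delta(\alpha\overline{\beta})$; e.g. $(\alpha+\alpha\gamma,\beta)=0$ means $\beta\ne\alpha$ and $\beta\neq\alpha\gamma$. For $\mathbf a=\alpha_1+\dots+\alpha_r\in P$ put $(\mathbf a)_\nu=\prod_i(\alpha_i)_\nu$ and $(\mathbf a)^\circ_\nu=\prod_i(\alpha_i)^\circ_\nu$. *)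

(* Defs.v *)
From HB Require Import structures.
From mathcomp Require Import all_boot all_order all_fingroup all_algebra.
From mathcomp Require Import cyclic reals.
From mathcomp.real_closed Require Import complex.

Set Implicit Arguments.
Unset Strict Implicit.
Unset Printing Implicit Defensive.

Import GRing.Theory.
Local Open Scope ring_scope.

Section Mchar.
Variables (F : finFieldType) (C : closedFieldType).

(* The morphism equations force the values to be nonzero, so these are exactly
   the group homomorphisms from F^* to C^*. *)
Definition is_mchar (h : {ffun {unit F} -> C}) : bool :=
  (h 1%g == 1) && [forall u, forall v, h (u * v)%g == h u * h v].

Record mchar := MChar { mchar_val : {ffun {unit F} -> C}; _ : is_mchar mchar_val }.

HB.instance Definition _ := [isSub for mchar_val].
HB.instance Definition _ := [Choice of mchar by <:].

Lemma mchar_val1 (c : mchar) : mchar_val c 1%g = 1.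
Proof. by case: c => h /= /andP[/eqP]. Qed.

Lemma mchar_valM (c : mchar) u v :
  mchar_val c (u * v)%g = mchar_val c u * mchar_val c v.
Proof. by case: c => h /= /andP[_ /forallP/(_ u)/forallP/(_ v)/eqP]. Qed.

Lemma mchar_valX (c : mchar) u n : mchar_val c (u ^+ n)%g = mchar_val c u ^+ n.
Proof.
elim: n => [|n IHn]; first by rewrite expg0 expr0 mchar_val1.
by rewrite expgS exprS mchar_valM IHn.
Qed.

Lemma mchar_val_neq0 (c : mchar) u : mchar_val c u != 0.
Proof.
apply/eqP => cu0; have := mchar_valM c u u^-1%g.
by rewrite mulgV mchar_val1 cu0 mul0r => /eqP; rewrite oner_eq0.
Qed.

Lemma is_mcharP (h : {unit F} -> C) :
  h 1%g = 1 -> (forall u v, h (u * v)%g = h u * h v) -> is_mchar (finfun h).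
Proof.
move=> h1 hM; rewrite /is_mchar ffunE h1 eqxx /=.
by apply/forallP => u; apply/forallP => v; rewrite !ffunE hM.
Qed.

Lemma mchar_ext (c d : mchar) :
  (forall u, mchar_val c u = mchar_val d u) -> c = d.
Proof. by move=> cd; apply/val_inj/ffunP. Qed.

(* Finiteness: every value is a root of 'X^#|F^*| - 1. *)
Let rts : seq C := sval (closed_field_poly_normal ('X^#|[set: {unit F}]| - 1%:P : {poly C})).

Lemma mchar_val_rts (c : mchar) u : mchar_val c u \in rts.
Proof.
rewrite /rts; case: closed_field_poly_normal => r /= rE.
have n0 : (0 < #|[set: {unit F}]|)%N by apply: cardG_gt0.
have : root ('X^#|[set: {unit F}]| - 1%:P) (mchar_val c u).
  rewrite rootE !hornerE -mchar_valX expg_cardG ?inE // mchar_val1.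
  by rewrite subrr.
rewrite rE lead_coefXnsubC // scale1r.
by rewrite root_prod_XsubC.
Qed.

Let enc (c : mchar) : {ffun {unit F} -> seq_sub rts} :=
  [ffun u => SeqSub (mchar_val_rts c u)].
Let dec (e : {ffun {unit F} -> seq_sub rts}) : option mchar :=
  insub [ffun u => val (e u)].
Let encK : pcancel enc dec.
Proof.
move=> c; rewrite /dec (_ : [ffun u => _] = val c) ?valK //.
by apply/ffunP => u; rewrite !ffunE.
Qed.

HB.instance Definition _ := Countable.copy mchar (pcan_type encK).
HB.instance Definition _ : isFinite mchar := PCanIsFinite encK.

Fact mchar_one_subproof : is_mchar [ffun _ => 1].
Proof. by apply: is_mcharP => // *; rewrite mulr1. Qed.
Definition mchar_one : mchar := MChar mchar_one_subproof.

Fact mchar_mul_subproof (c d : mchar) :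
  is_mchar [ffun u => mchar_val c u * mchar_val d u].
Proof.
by apply: is_mcharP => [|u v]; rewrite ?mchar_val1 ?mulr1 // !mchar_valM mulrACA.
Qed.
Definition mchar_mul (c d : mchar) : mchar := MChar (mchar_mul_subproof c d).

Fact mchar_inv_subproof (c : mchar) : is_mchar [ffun u => (mchar_val c u)^-1].
Proof.
by apply: is_mcharP => [|u v]; rewrite ?mchar_val1 ?invr1 // mchar_valM invfM.
Qed.
Definition mchar_inv (c : mchar) : mchar := MChar (mchar_inv_subproof c).

Fact mchar_mulA : associative mchar_mul.
Proof. by move=> a b c; apply: mchar_ext => u; rewrite /= !ffunE mulrA. Qed.
Fact mchar_mul1 : left_id mchar_one mchar_mul.
Proof. by move=> a; apply: mchar_ext => u; rewrite /= !ffunE mul1r. Qed.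
Fact mchar_mulV : left_inverse mchar_one mchar_inv mchar_mul.
Proof.
by move=> a; apply: mchar_ext => u; rewrite /= !ffunE mulVf ?mchar_val_neq0.
Qed.

HB.instance Definition _ :=
  Finite_isGroup.Build mchar mchar_mulA mchar_mul1 mchar_mulV.

(* Extension to F by 0 at 0, for the trivial character as well. *)
Definition mchar_ext0 (c : mchar) (x : F) : C :=
  if (insub x : option {unit F}) is Some u then mchar_val c u else 0.

End Mchar.

Coercion mchar_ext0 : mchar >-> Funclass.

Definition nontrivial_addchar (F : finFieldType) (C : closedFieldType)
    (psi : F -> C) : Prop :=
  [/\ psi 0 = 1, forall x y, psi (x + y) = psi x * psi y
    & exists x, psi x != 1].

Section Gauss.
Variables (F : finFieldType) (C : closedFieldType) (psi : F -> C).
Local Notation chars := (mchar F C).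

Definition delta (phi : chars) : nat := (phi == 1%g).

Definition gauss (phi : chars) : C := - \sum_(x : F) phi x * psi x.

Definition gausso (phi : chars) : C := #|F|%:R ^+ delta phi * gauss phi.

Definition poch (phi nu : chars) : C := gauss (phi * nu)%g / gauss phi.

Definition pocho (phi nu : chars) : C := gausso (phi * nu)%g / gausso phi.

(* The group of characters being finite, the free abelian monoid on it is the
   monoid of all functions from it to nat, under pointwise addition. *)
Definition charsum : Type := {ffun chars -> nat}.
HB.instance Definition _ := GRing.Nmodule.on charsum.

Definition fchar (phi : chars) : charsum := [ffun chi => (chi == phi) : nat].

Definition pairing (a b : charsum) : nat :=
  (\sum_(phi : chars) \sum_(chi : chars) a phi * b chi * delta (phi * chi^-1)%g)%N.

Definition spoch (a : charsum) (nu : chars) : C :=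
  \prod_(phi : chars) poch phi nu ^+ a phi.

Definition spocho (a : charsum) (nu : chars) : C :=
  \prod_(phi : chars) pocho phi nu ^+ a phi.

End Gauss.

Arguments fchar {F C} phi.
Arguments pairing {F C} a b.

(* Main.v *)
(** Since [f] is arbitrary, one compares the coefficients of [f mu * mu y].
    With [a = alpha mu], [b = beta mu], [c = gamma], the reflection formula for
    Gauss sums and the shift of [eta] by [mu] turn the identity of coefficients
    into Pfaff's transformation
      [2F1(a, c; b; x) = (1 - x)^(-a) 2F1(a, b/c; b; x/(x - 1))].
    As [a <> b], the quotient [(a)_nu / (b)_nu] is a Jacobi sum over [t], and
    summing over [nu] by the finite binomial theorem yields an Euler integral in
    [t], on which Pfaff's transformation is the substitution [t -> (1 - x) t].
    The binomial theorem for the parameter [1] has one extra term; it is met on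
    the right-hand side exactly when [b/c = 1], i.e. [mu = gamma/beta], and gives
    the last summand of the theorem. *)

Require Import Defs.
From mathcomp Require Import all_boot all_order all_fingroup all_algebra.
From mathcomp Require Import cyclic separable cyclotomic finfield reals ring.
From mathcomp.real_closed Require Import complex.

Set Implicit Arguments.
Unset Strict Implicit.
Unset Printing Implicit Defensive.

Import GRing.Theory Num.Theory.
Local Open Scope ring_scope.

(** As [n] is invertible, ['X^n - 1] is separable and has [n] distinct roots; [n] roots of unity in
    a field include a primitive one. *)
Lemma closed_prim_root_exists (C : closedFieldType) n :
  (n > 0)%N -> n%:R != 0 :> C -> exists z : C, n.-primitive_root z.
Proof.
move=> n_gt0 n_neq0.
have [r Dp] := closed_field_poly_normal ('X^n - 1 : {poly C}).
rewrite (monicP _) ?monicXnsubC // scale1r in Dp.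
have rn1 : all n.-unity_root r by apply/allP=> z; rewrite -root_prod_XsubC -Dp.
have sz_r : (n <= size r)%N.
  by rewrite -ltnS -(size_prod_XsubC r id) -Dp size_XnsubC.
have [|z _ zP] := hasP (has_prim_root n_gt0 rn1 _ sz_r); last by exists z.
by rewrite -separable_prod_XsubC -Dp separable_Xn_sub_1.
Qed.

(** * Characters extended by zero, and their sums over the field *)

Section Characters.
Variables (F : finFieldType) (C : closedFieldType).
Implicit Types (c d : mchar F C) (x y z : F).

Lemma mchar0 c : c 0 = 0.
Proof. by rewrite /mchar_ext0 insubN ?unitr0. Qed.

Lemma mchar_unit c (u : {unit F}) : c (val u) = mchar_val c u.
Proof. by rewrite /mchar_ext0 valK. Qed.

Variant mchar_arg_spec : F -> Type :=
  | MCharArg0 : mchar_arg_spec 0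
  | MCharArgUnit (u : {unit F}) : mchar_arg_spec (val u).

Lemma mchar_argP x : mchar_arg_spec x.
Proof.
have [->|x_neq0] := eqVneq x 0; first exact: MCharArg0.
have xU : x \is a GRing.unit by rewrite unitfE.
exact: (MCharArgUnit (FinRing.unit F xU)).
Qed.

Lemma mchar1 c : c 1 = 1.
Proof. by rewrite -(mchar_val1 c) -mchar_unit. Qed.

Lemma mcharM c x y : c (x * y) = c x * c y.
Proof.
case: (mchar_argP x) => [|u]; first by rewrite !mul0r mchar0 mul0r.
case: (mchar_argP y) => [|v]; first by rewrite !mulr0 mchar0 mulr0.
by rewrite -FinRing.val_unitM !mchar_unit mchar_valM.
Qed.

Lemma mchar_neq0 c x : (c x != 0) = (x != 0).
Proof.
case: (mchar_argP x) => [|u]; first by rewrite mchar0 !eqxx.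
rewrite mchar_unit mchar_val_neq0.
by symmetry; rewrite -unitfE; exact: (valP u).
Qed.

Lemma mcharV c x : c x^-1 = (c x)^-1.
Proof.
have [->|x_neq0] := eqVneq x 0; first by rewrite invr0 mchar0 invr0.
have cx_neq0 : c x != 0 by rewrite mchar_neq0.
by apply: (mulfI cx_neq0); rewrite -mcharM !divff // mchar1.
Qed.

Lemma mcharMg c d x : (c * d)%g x = c x * d x.
Proof.
case: (mchar_argP x) => [|u]; first by rewrite !mchar0 mul0r.
by rewrite !mchar_unit /= ffunE.
Qed.

Lemma mcharVg c x : (c^-1)%g x = (c x)^-1.
Proof.
case: (mchar_argP x) => [|u]; first by rewrite !mchar0 invr0.
by rewrite !mchar_unit /= ffunE.
Qed.

Lemma mchar1g x : (1%g : mchar F C) x = (x != 0)%:R.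
Proof.
case: (mchar_argP x) => [|u]; first by rewrite mchar0 eqxx.
by rewrite -[X in X != 0]/(val u) -unitfE (valP u) mchar_unit /= ffunE.
Qed.

Lemma mchar_mulgC c d : commute c d.
Proof. by apply: mchar_ext => u; rewrite /= !ffunE mulrC. Qed.

Lemma mchar_sqrN1 c : c (-1) * c (-1) = 1.
Proof. by rewrite -mcharM mulrNN mulr1 mchar1. Qed.

Lemma mcharVgN1 c : (c^-1)%g (-1) = c (-1).
Proof. by rewrite mcharVg -mcharV invrN invr1. Qed.

Lemma mchar_neq1P c : c != 1%g -> exists2 x, x != 0 & c x != 1.
Proof.
move=> c_neq1; have [/existsP[x /andP[]]|] :=
  boolP [exists x : F, (x != 0) && (c x != 1)]; first by exists x.
rewrite negb_exists => /forallP cx; case/eqP: c_neq1.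
apply: mchar_ext => u; rewrite ffunE -mchar_unit; apply/eqP.
by have := cx (val u); rewrite negb_and !negbK -(negbK (_ == 0)) -unitfE (valP u).
Qed.

(** Replacing [x] by [z * x] multiplies the sum by [c z], which can be chosen different from 1
    unless [c] is trivial. The [- 1] reflects the value 0 at 0. *)
Lemma sum_mchar c : \sum_(x : F) c x = (c == 1%g)%:R * (#|F|%:R - 1).
Proof.
have [->|/mchar_neq1P[z z_neq0 cz]] := eqVneq c 1%g.
  have -> : #|F|%:R = \sum_(x : F) 1 :> C by rewrite sumr_const.
  rewrite mul1r [in RHS](bigD1 0) //= addrC addrK (bigD1 0) //= mchar0 add0r.
  by apply: eq_bigr => x x_neq0; rewrite mchar1g x_neq0.
rewrite mul0r; apply: contraNeq cz => S_neq0.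
apply/eqP/(mulIf S_neq0); rewrite mul1r mulr_sumr.
rewrite [RHS](reindex_inj (mulfI z_neq0)) /=.
by apply: eq_bigr => x _; rewrite mcharM.
Qed.

End Characters.

(** * Orthogonality over the dual group *)

Section CharacterSums.
Variables (F : finFieldType) (C : numClosedFieldType).
Implicit Types (c d : mchar F C) (x y z : F).

Lemma card_neq0_natr : #|F|%:R != 0 :> C.
Proof. by rewrite pnatr_eq0 -lt0n; apply/card_gt0P; exists 0. Qed.

(** The unit group is cyclic; sending a generator to a root of unity of the same order gives a
    faithful character. *)
Lemma mchar_separates z : z != 0 -> z != 1 -> exists c : mchar F C, c z != 1.
Proof.
case: (mchar_argP z) => [|u]; first by rewrite eqxx.
move=> _ u_neq1; have /cyclicP[w wP] := field_unit_group_cyclic [set: {unit F}]%G.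
have [||zeta zetaP] := @closed_prim_root_exists C #[w]%g; rewrite ?order_gt0 //.
  by rewrite pnatr_eq0 -lt0n order_gt0.
have logP (v : {unit F}) : exists k, (w ^+ k == v)%g.
  have /cycleP[k ->] : v \in <[w]>%g by rewrite -wP inE.
  by exists k.
pose log v := xchoose (logP v).
have logK v : (w ^+ log v)%g = v by apply/eqP/(xchooseP (logP v)).
have eq_zeta i j : (zeta ^+ i == zeta ^+ j) = (w ^+ i == w ^+ j)%g.
  by rewrite (eq_prim_root_expr zetaP) eq_expg_mod_order.
have chiP : is_mchar (finfun (fun v => zeta ^+ log v)).
  apply: is_mcharP => [|v v'].
    by apply/eqP; rewrite -(expr0 zeta) eq_zeta logK expg0.
  by apply/eqP; rewrite -exprD eq_zeta expgD !logK.
exists (MChar chiP); rewrite mchar_unit ffunE -(expr0 zeta) eq_zeta logK expg0.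
by apply: contraNneq u_neq1 => ->.
Qed.

Lemma sum_mchar_neq1 z : z != 1 -> \sum_(c : mchar F C) c z = 0.
Proof.
move=> z_neq1; have [->|z_neq0] := eqVneq z 0.
  by rewrite big1 // => c _; rewrite mchar0.
have [d dz] := mchar_separates z_neq0 z_neq1.
apply: contraNeq dz => S_neq0; apply/eqP/(mulIf S_neq0); rewrite mul1r mulr_sumr.
rewrite [RHS](reindex_inj (mulgI d)) /=.
by apply: eq_bigr => c _; rewrite mcharMg.
Qed.

(* The number of characters comes from summing [c x] over all pairs [(c, x)]. *)
Lemma sum_dual z : \sum_(c : mchar F C) c z = (z == 1)%:R * (#|F|%:R - 1).
Proof.
have [->|/sum_mchar_neq1->] := eqVneq z 1; last by rewrite mul0r.
have <- : \sum_(x : F) \sum_(c : mchar F C) c x = \sum_(c : mchar F C) c 1.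
  by rewrite (bigD1 1) //= [X in _ + X]big1 ?addr0 // => x /sum_mchar_neq1.
rewrite exchange_big (eq_bigr _ (fun c _ => sum_mchar c)) /=.
by rewrite (bigD1 1%g) //= eqxx big1 ?addr0 // => c /negPf->; rewrite mul0r.
Qed.

End CharacterSums.

(** * Gauss and Jacobi sums, reflection and the binomial theorem *)

Section GaussSums.
Variables (F : finFieldType) (C : numClosedFieldType) (psi : F -> C).
Hypothesis psi_nontrivial : nontrivial_addchar psi.
Implicit Types (a b c d : mchar F C) (x y z : F).
Local Notation q := (#|F|%:R : C).
Local Notation g := (gauss psi).
Local Notation go := (gausso psi).

Definition jacobi c d : C := \sum_(t : F) c t * d (1 - t).

Lemma sum_addchar : \sum_(x : F) psi x = 0.
Proof.
case: psi_nontrivial => _ psiD [y]; apply: contraNeq => S_neq0.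
apply/eqP/(mulIf S_neq0); rewrite mul1r mulr_sumr [RHS](reindex_inj (addrI y)).
by apply: eq_bigr => x _; rewrite psiD.
Qed.

Lemma gauss1 : g 1%g = 1.
Proof.
have [psi0 _ _] := psi_nontrivial; have := sum_addchar.
rewrite /gauss (bigD1 0) //= psi0 => /eqP; rewrite addr_eq0 => /eqP->.
rewrite (bigD1 0) //= mchar0 mul0r add0r; congr (- _).
by apply: eq_bigr => x x_neq0; rewrite mchar1g x_neq0 mul1r.
Qed.

(** The double sum is sorted by [s = x + y]: [s = 0] gives a complete character sum, and for
    [s != 0] the scaling [x = s * t] splits off a Jacobi sum. *)
Lemma gauss_mul c d :
  g c * g d = ((c * d)%g == 1%g)%:R * (q - 1) * d (-1) - jacobi c d * g (c * d)%g.
Proof.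
have [psi0 psiD _] := psi_nontrivial.
have -> : g c * g d = \sum_(s : F) psi s * \sum_(x : F) c x * d (s - x).
  rewrite /gauss mulrNN mulr_suml.
  under [RHS]eq_bigr do rewrite mulr_sumr.
  rewrite [RHS]exchange_big /=; apply: eq_bigr => x _; rewrite mulr_sumr.
  rewrite [RHS](reindex_inj (addrI x)) /=; apply: eq_bigr => y _.
  by rewrite psiD [x + y]addrC addrK; ring.
rewrite (bigD1 0) //= psi0 mul1r; congr (_ + _).
  rewrite -sum_mchar mulr_suml; apply: eq_bigr => x _.
  by rewrite sub0r -[- x]mulN1r mcharM mcharMg; ring.
rewrite /gauss mulrN opprK mulr_sumr [RHS](bigD1 0) //= mchar0 mul0r mulr0 add0r.
apply: eq_bigr => s s_neq0.
rewrite (reindex_inj (mulfI s_neq0)) mcharMg /jacobi mulr_sumr mulr_suml /=.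
by apply: eq_bigr => t _; rewrite -[X in X - _]mulr1 -mulrBr !mcharM; ring.
Qed.

(** The summand is [c (t / (1 - t))], and [t / (1 - t)] takes every value except [-1] once as [t]
    runs over [t != 1]. *)
Lemma jacobi_inv c : jacobi c c^-1%g = (c == 1%g)%:R * (q - 1) - c (-1).
Proof.
rewrite -sum_mchar (reindex_inj (subIr 1)) (bigD1 0) //= sub0r addrAC subrr add0r.
(* Substitution [t = 1 - v^-1]; since [0^-1 = 0], the point [v = 0] is [t = 1], where the term
   vanishes. *)
rewrite /jacobi (reindex_inj (subrI 1)) (reindex_inj invr_inj) /=.
rewrite (bigD1 0) //= invr0 subr0 subrr mchar0 mulr0 add0r.
apply: eq_bigr => v v_neq0; rewrite subKr mcharVg mcharV invrK -mcharM.
by rewrite mulrBl mulVf // mul1r.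
Qed.

(** Reflection formula; the power of [q] in [go] makes the trivial character fit, as [g 1 = 1]. *)
Lemma gauss_inv c : g c * go c^-1%g = q * c (-1).
Proof.
rewrite /gausso /delta mulrCA gauss_mul mulgV eqxx gauss1 jacobi_inv mcharVgN1.
rewrite invg_eq1; have [->|_] := eqVneq c 1%g; last by rewrite /=; ring.
by rewrite mchar1g oppr_eq0 oner_eq0 /=; ring.
Qed.

Lemma gauss_neq0 c : g c != 0.
Proof.
have : g c * go c^-1%g != 0.
  by rewrite gauss_inv mulf_neq0 ?card_neq0_natr // mchar_neq0 oppr_eq0 oner_eq0.
by rewrite mulf_eq0 negb_or => /andP[].
Qed.

Lemma gaussoE c : go c = q * c (-1) / g c^-1%g.
Proof.
have := gauss_inv c^-1%g; rewrite invgK mcharVgN1 => <-.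
by rewrite mulrC mulKf ?gauss_neq0.
Qed.

Lemma gausso1 : go 1%g = q.
Proof. by rewrite /gausso /delta eqxx gauss1 mulr1 expr1. Qed.

(* The finite analogue of [1F0(d; z) = (1 - z)^(-d)], corrected for [d = 1]. *)
Lemma gauss_binomial d z : z != 0 ->
  \sum_(nu : mchar F C) g (d * nu)%g * g nu^-1%g * nu (- z) =
  (1 - q) * g d * (d^-1)%g (1 - z) + (d == 1%g)%:R * (1 - q) ^+ 2 * (z == 1)%:R.
Proof.
move=> z_neq0.
(* Expanding the product of Gauss sums as a Jacobi sum gathers all dependence on [nu] into
   [nu (w t)], ready for orthogonality. *)
pose w t := - z * (t / (1 - t)).
have termE nu : g (d * nu)%g * g nu^-1%g * nu (- z) =
    (d == 1%g)%:R * (q - 1) * nu z - g d * \sum_(t : F) d t * nu (w t).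
  rewrite gauss_mul mulgK mcharVgN1 mulrBl; congr (_ - _).
    by rewrite -[- z]mulN1r mcharM -!mulrA (mulrA (nu (-1))) mchar_sqrN1 mul1r.
  rewrite mulrAC mulrC; congr (_ * _); rewrite mulr_suml.
  by apply: eq_bigr => t _; rewrite mcharMg mcharVg /w !mcharM mcharV; ring.
rewrite (eq_bigr _ (fun nu _ => termE nu)) sumrB -mulr_sumr sum_dual addrC.
congr (_ + _); last by ring.
rewrite -mulr_sumr exchange_big /= (eq_bigr (fun t => d t * ((w t == 1)%:R * (q - 1)))).
  2: by move=> t _; rewrite -mulr_sumr sum_dual.
(* [w t = 1] amounts to [(1 - z) * t = 1], which has no solution for [z = 1] and exactly one
   otherwise. *)
have [z1|z_neq1] := eqVneq z 1.
  rewrite z1 subrr mchar0 mulr0 big1 ?mulr0 ?oppr0 // => t _.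
  suff /negPf-> : w t != 1 by rewrite mul0r mulr0.
  rewrite /w; have [->|t_neq1] := eqVneq (1 - t) 0.
    by rewrite invr0 !mulr0 eq_sym oner_eq0.
  rewrite z1 mulN1r -subr_eq0 (_ : _ - 1 = - (1 - t)^-1); last by field.
  by rewrite oppr_eq0 invr_eq0.
have z1_neq0 : 1 - z != 0 by rewrite subr_eq0 eq_sym.
have wE t : (w t == 1) = (t == (1 - z)^-1).
  have [->|t_neq1] := eqVneq t 1.
    rewrite /w subrr invr0 !mulr0 eq_sym oner_eq0; symmetry.
    apply: contraNF z_neq0 => /eqP/(congr1 GRing.inv); rewrite invrK invr1 => z1.
    by rewrite -(subKr 1 z) -z1 subrr.
  have t1_neq0 : 1 - t != 0 by rewrite subr_eq0 eq_sym.
  rewrite -subr_eq0 -[RHS]subr_eq0.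
  have -> : w t - 1 = (t - (1 - z)^-1) * ((1 - z) / (1 - t)).
    by rewrite /w; field; rewrite z1_neq0 t1_neq0.
  by rewrite !mulf_eq0 invr_eq0 (negPf z1_neq0) (negPf t1_neq0) !orbF.
rewrite (bigD1 (1 - z)^-1) //= wE eqxx big1 => [|t /negPf t_neq].
  by rewrite mcharVg mcharV /=; ring.
by rewrite wE t_neq mul0r mulr0.
Qed.

(** * Hypergeometric sums and Pfaff's transformation *)

(* Up to normalisation this is [2F1(a, c; b; z)]. *)
Definition hyper_sum a b c z : C :=
  \sum_(nu : mchar F C) (g (a * nu)%g * g ((b * nu)^-1)%g * (b * nu)%g (-1)
    * (g (c * nu)%g * g nu^-1%g)) * nu (- z).

(** Euler's integral, up to sign, with [t / (t - 1)] put for the usual variable, so that [z] enters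
    only through [(1 - z) * t]. *)
Definition euler_sum a b c z : C :=
  \sum_(t : F) a t * (c * b^-1)%g (1 - t) * (c^-1)%g (1 - (1 - z) * t).

(** Because [a != b], the product of the two Gauss sums in [a] and [b] is a pure Jacobi sum; the sum
    over [nu] inside it is then [gauss_binomial] at [w t]. *)
Lemma hyper_sum_euler a b c z : a != b -> z != 0 -> z != 1 ->
  hyper_sum a b c z = (q - 1) * g (a * b^-1)%g * b (-1) *
    (g c * euler_sum a b c z
     + (c == 1%g)%:R * (1 - q) * (a^-1)%g (1 - z) * (b^-1)%g (z / (z - 1))).
Proof.
move=> a_neq_b z_neq0 z_neq1.
have ab_neq1 : (a * b^-1)%g != 1%g by rewrite -eq_mulgV1.
pose w t := z * t / (t - 1).
have z1_neq0 : z - 1 != 0 by rewrite subr_eq0.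
have z1'_neq0 : 1 - z != 0 by rewrite subr_eq0 eq_sym.
pose A t := a t * (b^-1)%g (1 - t).
have A0 : A 0 = 0 by rewrite /A mchar0 mul0r.
have A1 : A 1 = 0 by rewrite /A subrr mchar0 mulr0.
have betaE nu : g (a * nu)%g * g ((b * nu)^-1)%g * (b * nu)%g (-1) * nu (- z) =
    - (g (a * b^-1)%g * b (-1)) * \sum_(t : F) A t * nu (- w t).
  rewrite gauss_mul; have -> : (a * nu * (b * nu)^-1 = a * b^-1)%g.
    by rewrite invMg mulgA mulgK.
  rewrite (negPf ab_neq1) !mul0r sub0r.
  suff: (b * nu)%g (-1) * nu (- z) * jacobi (a * nu)%g (b * nu)^-1%g =
      b (-1) * \sum_(t : F) A t * nu (- w t) by move=> bE; ring: bE.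
  rewrite /jacobi !mulr_sumr; apply: eq_bigr => t _.
  have -> : - w t = -1 * (- z) * t * (1 - t)^-1.
    by rewrite /w -[t - 1]opprB invrN; ring.
  by rewrite /A !mcharMg !mcharVg !mcharMg !invfM !mcharM mcharV; ring.
have -> : hyper_sum a b c z = - (g (a * b^-1)%g * b (-1)) * \sum_(t : F)
    A t * ((1 - q) * g c * (c^-1)%g (1 - w t)
           + (c == 1%g)%:R * (1 - q) ^+ 2 * (w t == 1)%:R).
  transitivity (- (g (a * b^-1)%g * b (-1)) * \sum_(nu : mchar F C)
      \sum_(t : F) A t * (g (c * nu)%g * g nu^-1%g * nu (- w t))).
    rewrite mulr_sumr; apply: eq_bigr => nu _; rewrite mulrAC betaE -mulrA.
    by congr (_ * _); rewrite mulr_suml; apply: eq_bigr => t _; ring.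
  congr (_ * _); rewrite exchange_big; apply: eq_bigr => t _ /=.
  (* [gauss_binomial] requires [w t != 0], which fails at [t = 0] and, as [0^-1 = 0], at [t = 1];
     [A] vanishes at both. *)
  rewrite -mulr_sumr; have [->|t_neq0] := eqVneq t 0; first by rewrite A0 !mul0r.
  have [->|t_neq1] := eqVneq t 1; first by rewrite A1 !mul0r.
  rewrite gauss_binomial // /w !mulf_neq0 // invr_eq0 subr_eq0.
  by rewrite t_neq1.
have wE t : t != 1 -> (w t == 1) = (t == (1 - z)^-1).
  rewrite -subr_eq0 => t1_neq0; rewrite -subr_eq0 -[RHS]subr_eq0.
  have -> : w t - 1 = (t - (1 - z)^-1) * ((z - 1) / (t - 1)).
    by rewrite /w; field; rewrite z1'_neq0 t1_neq0.
  by rewrite !mulf_eq0 invr_eq0 (negPf z1_neq0) (negPf t1_neq0) !orbF.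
have z1V_neq1 : (1 - z)^-1 != 1.
  apply: contraNneq z_neq0 => /(congr1 GRing.inv); rewrite invrK invr1 => z1.
  by rewrite -(subKr 1 z) z1 subrr.
have sumE : \sum_(t : F) A t * (w t == 1)%:R
    = (a^-1)%g (1 - z) * (b^-1)%g (z / (z - 1)).
  rewrite (bigD1 (1 - z)^-1) //= wE // eqxx mulr1 big1 ?addr0 => [|t t_neq].
    rewrite /A [(a^-1)%g _]mcharVg mcharV; congr (_ * (b^-1)%g _).
    by field; rewrite z1'_neq0 z1_neq0.
  have [->|t_neq1] := eqVneq t 1; first by rewrite A1 mul0r.
  by rewrite wE // (negPf t_neq) mulr0.
have eulerE : \sum_(t : F) A t * (c^-1)%g (1 - w t) = euler_sum a b c z.
  apply: eq_bigr => t _; have [->|t_neq1] := eqVneq t 1.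
    by rewrite A1 subrr !mchar0 mulr0 !mul0r.
  have t1_neq0 : 1 - t != 0 by rewrite subr_eq0 eq_sym.
  have -> : 1 - w t = (1 - (1 - z) * t) / (1 - t).
    by rewrite /w; field; rewrite t1_neq0 subr_eq0 t_neq1.
  by rewrite /A !mcharMg !mcharVg mcharM mcharV invfM invrK; ring.
under eq_bigr do rewrite mulrDr mulrCA [A _ * (_ * (w _ == 1)%:R)]mulrCA.
by rewrite big_split /= -!mulr_sumr sumE eulerE; ring.
Qed.

(* Pfaff's transformation; the extra term appears when [b = c]. *)
Lemma hyper_sum_pfaff a b c x : a != b -> c != 1%g -> x != 0 -> x != 1 ->
  g (b * c^-1)%g * hyper_sum a b c x =
  g c * ((a^-1)%g (1 - x) * hyper_sum a b (b * c^-1)%g (x / (x - 1))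
         + (b == c)%:R * (1 - q) ^+ 2 * g (a * b^-1)%g * b (-1) * (b^-1)%g x).
Proof.
move=> a_neq_b c_neq1 x_neq0 x_neq1.
have x1_neq0 : x - 1 != 0 by rewrite subr_eq0.
have x1'_neq0 : 1 - x != 0 by rewrite subr_eq0 eq_sym.
set x' := x / (x - 1); have x'_neq0 : x' != 0 by rewrite mulf_neq0 ?invr_eq0.
have x'E : 1 - x' = (1 - x)^-1.
  by rewrite /x'; field; rewrite x1_neq0 x1'_neq0.
have x'_neq1 : x' != 1 by rewrite eq_sym -subr_eq0 x'E invr_eq0.
have x'K : x' / (x' - 1) = x.
  by rewrite -opprB x'E invrN invrK opprB divfK.
have ax_neq0 : a (1 - x) != 0 by rewrite mchar_neq0.
(* The substitution [t -> (1 - x) * t] swaps the last two factors, and [c -> b / c] swaps their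
   characters. *)
have eulerE : euler_sum a b (b * c^-1)%g x' = a (1 - x) * euler_sum a b c x.
  rewrite /euler_sum x'E (reindex_inj (mulfI x1'_neq0)) mulr_sumr /=.
  apply: eq_bigr => t _; rewrite mulKf // mcharM.
  rewrite (_ : b * c^-1 * b^-1 = c^-1)%g; last first.
    by rewrite -mulgA (mchar_mulgC c^-1%g) mulgA mulgV mul1g.
  by rewrite invMg invgK; ring.
rewrite !hyper_sum_euler // (negPf c_neq1) eulerE x'E x'K -eq_mulgV1.
rewrite !mcharVg mcharV invrK.
(* For [b = c] the correction in [hyper_sum_euler] at [x'] carries [(q - 1) * (1 - q)] and cancels
   the added term. *)
have [<-|_] := eqVneq b c; last first.
  by rewrite /= !mul0r !addr0; field.
by rewrite mulgV gauss1 /= !mul0r addr0; field; rewrite ax_neq0 mchar_neq0 x_neq0.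
Qed.

(** Reflection moves the denominators of the Pochhammer quotients into numerators, the shape of
    [hyper_sum]. *)
Lemma gausso_V c : (go c)^-1 = c (-1) * g c^-1%g / q.
Proof. by rewrite gaussoE invf_div invfM -mcharV invrN invr1; ring. Qed.

Lemma pocho_V c d : (pocho psi c d)^-1 = go c * ((c * d)%g (-1) * g (c * d)^-1%g / q).
Proof. by rewrite /pocho invf_div gausso_V. Qed.

Lemma pocho1_V d : (pocho psi 1%g d)^-1 = d (-1) * g d^-1%g.
Proof. by rewrite pocho_V gausso1 mul1g mulrC divfK ?card_neq0_natr. Qed.

(** Both inner sums are multiples of a [hyper_sum] with parameters twisted by [mu], related by
    [hyper_sum_pfaff]. *)
Lemma hyper_sum_coef (alpha beta gamma mu : mchar F C) x :
  alpha != beta -> gamma != 1%g -> x != 0 -> x != 1 ->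
  \sum_(nu : mchar F C)
    poch psi alpha (nu * mu)%g * poch psi gamma nu * poch psi (beta * gamma^-1)%g mu
      / (pocho psi beta (nu * mu)%g * pocho psi 1%g nu * pocho psi 1%g mu) * nu x
  = (alpha^-1)%g (1 - x) * (\sum_(eta : mchar F C)
      poch psi alpha eta * poch psi (beta * gamma^-1)%g eta
      / (pocho psi beta eta * pocho psi 1%g eta) * eta (x / (x - 1))
      * (poch psi (eta^-1)%g mu / pocho psi 1%g mu)) / mu x
    + (mu == beta^-1 * gamma)%g%:R * ((1 - q) ^+ 2 * (gamma^-1)%g x
      * (pocho psi 1%g beta / pocho psi (alpha^-1)%g beta)).
Proof.
move=> al_be ga_neq1 x_neq0 x_neq1.
have [P PE] : {P | P = pocho psi 1%g mu} by exists (pocho psi 1%g mu).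
rewrite -PE.
have dE : (beta * mu * gamma^-1 = beta * gamma^-1 * mu)%g.
  by rewrite -!mulgA (mchar_mulgC mu).
(* Rewriting with [invfM] itself would also unfold [pocho], which is a quotient. *)
have invM2 (u v : C) : (u * v)^-1 = u^-1 * v^-1 by rewrite invfM.
have invM3 (u v w : C) : (u * v * w)^-1 = u^-1 * v^-1 * w^-1 by rewrite !invfM.
pose K := go beta / (q * g alpha * g (beta * gamma^-1)%g) / P.
have -> : \sum_(nu : mchar F C)
    poch psi alpha (nu * mu)%g * poch psi gamma nu * poch psi (beta * gamma^-1)%g mu
      / (pocho psi beta (nu * mu)%g * pocho psi 1%g nu * P) * nu x
    = K / g gamma * (g (beta * mu * gamma^-1)%g
        * hyper_sum (alpha * mu)%g (beta * mu)%g gamma x).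
  rewrite mulrA /hyper_sum mulr_sumr; apply: eq_bigr => nu _.
  rewrite [(nu * mu)%g]mchar_mulgC invM3 (pocho_V beta (mu * nu)%g) (pocho1_V nu).
  rewrite /poch /K !mulgA dE [(q * _ * _)^-1]invM3 -[- x]mulN1r (mcharM nu).
  by ring.
have -> : \sum_(eta : mchar F C)
      poch psi alpha eta * poch psi (beta * gamma^-1)%g eta
      / (pocho psi beta eta * pocho psi 1%g eta) * eta (x / (x - 1))
      * (poch psi (eta^-1)%g mu / P)
    = K * mu (- (x / (x - 1))) * hyper_sum (alpha * mu)%g (beta * mu)%g
        (beta * mu * gamma^-1)%g (x / (x - 1)).
  (* With [eta = mu * zeta], the denominator of [poch psi eta^-1 mu] cancels the Gauss sum coming
     from [pocho psi 1 eta]. *)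
  rewrite /hyper_sum mulr_sumr (reindex_inj (mulgI mu)) /=.
  apply: eq_bigr => zeta _.
  rewrite invM2 (pocho_V beta (mu * zeta)%g) (pocho1_V (mu * zeta)%g).
  rewrite /poch /K !mulgA dE [(q * _ * _)^-1]invM3.
  rewrite (_ : (mu * zeta)^-1 * mu = zeta^-1)%g; last by rewrite invMg mulgKV.
  rewrite -[- (x / _)]mulN1r !(mcharM mu (-1)) !(mcharM zeta (-1)).
  rewrite !(mcharMg mu zeta).
  have gV : g (mu * zeta)^-1%g / g (mu * zeta)^-1%g = 1 by rewrite divff ?gauss_neq0.
  by ring: gV.
rewrite hyper_sum_pfaff //; last first.
  by apply: contraNneq al_be => /mulIg->.
rewrite mulrA divfK ?gauss_neq0 // mulrDr; congr (_ + _).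
  (* [mu (x / (1 - x))] turns [alpha^-1 (1 - x)] into [(alpha * mu)^-1 (1 - x)], and its [mu x]
     cancels against [/ mu x]. *)
  rewrite (_ : - (x / (x - 1)) = x / (1 - x)); last first.
    by rewrite -[x - 1]opprB invrN mulrN opprK.
  have muV : mu x / mu x = 1 by rewrite divff // mchar_neq0.
  rewrite !mcharVg (mcharMg alpha) (mcharM mu) (mcharV mu) invM2.
  by ring: muV.
have -> : ((beta * mu)%g == gamma) = (mu == beta^-1 * gamma)%g.
  by rewrite -[RHS](inj_eq (mulgI beta)) mulKVg.
have [muE|_] := eqVneq mu (beta^-1 * gamma)%g; last by rewrite !mul0r mulr0.
have mulmu : (beta * mu = gamma)%g by rewrite muE mulKVg.
rewrite mulmu (_ : alpha * mu * gamma^-1 = alpha * beta^-1)%g; last first.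
  by rewrite muE !mulgA mulgK.
rewrite (pocho_V alpha^-1%g beta) (gaussoE alpha^-1%g) invgK.
rewrite (_ : (alpha^-1 * beta)^-1 = alpha * beta^-1)%g; last first.
  by rewrite invMg invgK mchar_mulgC.
rewrite (mcharMg alpha^-1%g beta) (mcharVgN1 alpha).
rewrite [pocho psi 1%g beta]/pocho gausso1 mul1g /K PE (pocho1_V mu) invM3.
rewrite (_ : mu^-1 = beta * gamma^-1)%g; last first.
  by rewrite muE invMg invgK mchar_mulgC.
have -> : gamma (-1) = beta (-1) * mu (-1) by rewrite -mulmu mcharMg.
have gV : g (beta * gamma^-1)%g / g (beta * gamma^-1)%g = 1.
  by rewrite divff ?gauss_neq0.
have qV : q / q = 1 by rewrite divff ?card_neq0_natr.
by ring: gV qV (mchar_sqrN1 alpha) (mchar_sqrN1 mu).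
Qed.

End GaussSums.

(** * Formal sums of characters and comparison of coefficients *)

Lemma pairing_eq0 (F : finFieldType) (C : closedFieldType) (a b : charsum F C) phi :
  pairing a b = 0%N -> (a phi * b phi = 0)%N.
Proof.
move/eqP; rewrite /pairing sum_nat_eq0 => /forallP/(_ phi) /=.
rewrite sum_nat_eq0 => /forallP/(_ phi) /=.
by rewrite /delta mulgV eqxx muln1 => /eqP.
Qed.

(** A general [G] serves [spoch] and [spocho] alike; exponents add, so [a] and [b] may coincide. *)
Lemma prod_fcharD (F : finFieldType) (C : closedFieldType) (G : mchar F C -> C) a b :
  \prod_phi G phi ^+ ((fchar a + fchar b)%R : charsum F C) phi = G a * G b.
Proof.
under eq_bigr => phi _ do rewrite !ffunE exprD.
rewrite big_split /=; congr (_ * _).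
  by rewrite (bigD1 a) //= eqxx big1 ?mulr1 // => phi /negPf->.
by rewrite (bigD1 b) //= eqxx big1 ?mulr1 // => phi /negPf->.
Qed.

Theorem theorem3p1 (R : realType) (F : finFieldType) (psi : F -> R[i])
    (psi_nontrivial : nontrivial_addchar psi)
    (alpha beta gamma : mchar F R[i])
    (alpha_beta : pairing (fchar alpha + fchar (alpha * gamma)%g) (fchar beta) = 0%N)
    (gamma_eps : pairing (fchar gamma) (fchar 1%g) = 0%N)
    (f : mchar F R[i] -> R[i]) (x y : F) (x_neq0 : x != 0) (x_neq1 : x != 1) :
  \sum_(nu : mchar F R[i]) \sum_(mu : mchar F R[i])
     f mu * ((poch psi alpha (nu * mu)%g * poch psi gamma nu
              * poch psi (beta * gamma^-1)%g mu)
             / (pocho psi beta (nu * mu)%g * pocho psi 1%g nu * pocho psi 1%g mu))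
     * nu x * mu y
  = (alpha^-1)%g (1 - x)
      * (\sum_(eta : mchar F R[i])
           spoch psi (fchar alpha + fchar (beta * gamma^-1)%g) eta
           / spocho psi (fchar beta + fchar 1%g) eta
           * eta (x / (x - 1))
           * \sum_(mu : mchar F R[i])
               f mu * (poch psi (eta^-1)%g mu / pocho psi 1%g mu) * mu (y / x))
    + (1 - #|F|%:R) ^+ 2 * f (beta^-1 * gamma)%g * (gamma^-1)%g x
      * (beta^-1 * gamma)%g y * (pocho psi 1%g beta / pocho psi (alpha^-1)%g beta).
Proof.
have al_be : alpha != beta.
  have := pairing_eq0 beta alpha_beta; rewrite !ffunE eqxx muln1 => /eqP.
  by rewrite addn_eq0 eqb0 eq_sym => /andP[].
have ga_neq1 : gamma != 1%g.
  have := pairing_eq0 1%g gamma_eps; rewrite !ffunE eqxx muln1 => /eqP.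
  by rewrite eqb0 eq_sym.
set p := pocho psi 1%g beta / _.
rewrite exchange_big /=.
transitivity (\sum_(mu : mchar F R[i]) f mu * mu y *
    \sum_(nu : mchar F R[i]) poch psi alpha (nu * mu)%g * poch psi gamma nu
      * poch psi (beta * gamma^-1)%g mu
      / (pocho psi beta (nu * mu)%g * pocho psi 1%g nu * pocho psi 1%g mu) * nu x).
  by apply: eq_bigr => mu _; rewrite mulr_sumr; apply: eq_bigr => nu _; ring.
rewrite (eq_bigr _ (fun mu _ => congr1 ( *%R (f mu * mu y))
  (hyper_sum_coef psi_nontrivial mu al_be ga_neq1 x_neq0 x_neq1))).
under eq_bigr do rewrite mulrDr.
rewrite big_split /=; congr (_ + _); last first.
  (* The indicator in [hyper_sum_coef] leaves the single index of the extra summand. *)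
  rewrite (bigD1 (beta^-1 * gamma)%g) //= eqxx mul1r big1 ?addr0.
    by rewrite /p; ring.
  by move=> mu /negPf->; rewrite mul0r mulr0.
under [in RHS]eq_bigr do rewrite /spoch /spocho !prod_fcharD mulr_sumr.
rewrite [in RHS]exchange_big mulr_sumr /=; apply: eq_bigr => mu _.
rewrite -[X in _ * X = _]mulrA mulrCA; congr (_ * _).
rewrite mulr_suml mulr_sumr; apply: eq_bigr => eta _.
by rewrite (mcharM mu) mcharV; ring.
Qed.
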